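(* There exists a sequence of finite simple graphs $G_n$ with $|G_n| \to \infty$ and edge density $p_n = 2e_{G_n}/|G_n|^2$ satisfying $p_n = |G_n|^{-o(1)}$, such that for every finite simple graph $F$, writing $\triangle_F$ for the number of triangles in $F$, \[ t_{p_n}(F, G_n) \to e^{-\triangle_F} \qquad \text{as } n \to \infty. \] Moreover, there is no kernel $W$ satisfying $t(F, W) = e^{-\triangle_F}$ for all finite simple graphs $F$.
   Context: For a graph $G$, $|G|$ denotes the number of vertices and $e_G$ the number of edges. $\hom(F,G)$ is the number of graph homomorphisms from $F$ to $G$. For real $p>0$, the normalized $F$-density is $t_p(F,G) = \hom(F,G)/(p^{e_F}|G|^{|F|})$. A kernel is a symmetric measurable function $W\colon [0,1]^2 \to [0,\infty)$ (symmetric meaning $W(x,y)=W(y,x)$). For a graph $H$, $t(H,W) = \int_{[0,1]^{V(H)}} \prod_{uv \in E(H)} W(x_u,x_v) \prod_{v\in V(H)} dx_v$. *)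

(* Defs.v *)
From HB Require Import structures.
From mathcomp Require Import all_boot all_order all_algebra.
From mathcomp Require Import all_classical all_reals all_analysis.

Set Implicit Arguments.
Unset Strict Implicit.
Unset Printing Implicit Defensive.

Import Order.TTheory GRing.Theory Num.Theory.
Import numFieldNormedType.Exports.

Local Open Scope classical_set_scope.
Local Open Scope ring_scope.

Record sgraph := SGraph {
  vertex :> finType;
  adj : rel vertex;
  adj_sym : symmetric adj;
  adj_irr : irreflexive adj }.

Section Graphs.
Local Open Scope nat_scope.

(* Each unordered edge {u, v} is represented once, by the ordered pair (u, v)
   in which u precedes v in the canonical enumeration of the vertices. *)
Definition edges (G : sgraph) : {set G * G} :=
  [set e : G * G | adj e.1 e.2 & enum_rank e.1 < enum_rank e.2]%SET.

Definition triangles (G : sgraph) : {set {set G}} :=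
  [set S : {set G} | #|S| == 3 &
     [forall u in S, forall v in S, (u != v) ==> adj u v]]%SET.

Definition homs (F G : sgraph) : {set {ffun F -> G}} :=
  [set f : {ffun F -> G} | [forall u, forall v, adj u v ==> adj (f u) (f v)]]%SET.

End Graphs.

Definition edge_density (R : realType) (G : sgraph) : R :=
  2 * #|edges G|%:R / #|G|%:R ^+ 2.

Definition normalized_density (R : realType) (p : R) (F G : sgraph) : R :=
  #|homs F G|%:R / (p ^+ #|edges F| * #|G|%:R ^+ #|F|).

Section PowerMeasure.
Context d (T : measurableType d) (R : realType).

Definition pair_cons n (x : T * n.-tuple T) : n.+1.-tuple T :=
  [tuple of x.1 :: x.2].

Lemma measurable_pair_cons n : measurable_fun setT (@pair_cons n).
Proof. exact: measurable_cons. Qed.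

HB.instance Definition _ n :=
  isMeasurableFun.Build _ _ _ _ (@pair_cons n) (@measurable_pair_cons n).

(* The n-fold product of P with itself, on n.-tuple T; power_prob_box below
   is the characteristic property. *)
Fixpoint power_prob (P : probability T R) (n : nat) :
    probability (n.-tuple T) R :=
  match n with
  | 0%N => \d_[tuple]
  | m.+1 => distribution (P \x power_prob P m)%E (@pair_cons m)
  end.

Lemma power_prob_box (P : probability T R) n (A : 'I_n -> set T) :
  (forall i, measurable (A i)) ->
  power_prob P n [set x | forall i, A i (tnth x i)] = (\prod_(i < n) P (A i))%E.
Proof.
elim: n A => [|n IHn] A mA /=.
  rewrite big_ord0 diracE mem_set//.
  by case.
rewrite big_ord_recl -IHn; last by move=> i; exact: mA.
rewrite /distribution /pushforward -product_measure1E//; last first.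
  rewrite (_ : mkset _ = \bigcap_(i in [set: 'I_n])
      ((@tnth _ T ^~ i) @^-1` A (lift ord0 i))); last first.
    by apply/seteqP; split => x /= h i; [move=> _|]; exact: h.
  apply: fin_bigcap_measurable => // i _.
  by rewrite -[X in measurable X]setTI; exact: measurable_tnth.
congr (_ _); apply/seteqP; split => -[x y] /= h.
  split; first exact: (h ord0).
  by move=> i; have := h (lift ord0 i); rewrite /pair_cons tnthS.
move=> i; case: (unliftP ord0 i) => [j|] ->.
  by rewrite /pair_cons tnthS; exact: h.2.
exact: h.1.
Qed.

End PowerMeasure.

Section Kernels.
Context (R : realType).

Definition unit_cube (n : nat) : set (n.-tuple R) :=
  [set x | forall i, tnth x i \in `[0, 1]].

(* A function on [0,1]^2 is represented by a function on R * R, of which only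
   the values on [0,1]^2 matter. *)
Definition is_kernel (W : R * R -> R) : Prop :=
  [/\ measurable_fun (`[0, 1]%classic `*` `[0, 1]%classic : set (R * R)) W,
      {in `[0, 1] &, forall x y, 0 <= W (x, y)} &
      {in `[0, 1] &, forall x y, W (x, y) = W (y, x)}].

(* The coordinate x_v of x : [0,1]^V(H) is the entry of x at the rank of v in
   the enumeration of V(H); uniform_prob on [0, 1] is the Lebesgue measure
   on [0,1]. *)
Definition kernel_density (H : sgraph)
    (W : R * R -> R) : \bar R :=
  (\int[power_prob (uniform_prob (@ltr01 R)) #|H|]_(x in @unit_cube #|H|)
     (\prod_(e in edges H)
        W (tnth x (enum_rank e.1), tnth x (enum_rank e.2)))%R%:E)%E.

End Kernels.

(* Main.v *)
Require Import Defs.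
From HB Require Import structures.
From mathcomp Require Import all_boot all_order all_algebra.
From mathcomp Require Import all_classical all_reals all_analysis.
From mathcomp Require Import measurable_realfun ring lra.

Set Implicit Arguments.
Unset Strict Implicit.
Unset Printing Implicit Defensive.

Import Order.TTheory GRing.Theory Num.Theory.
Import numFieldNormedType.Exports.

Local Open Scope classical_set_scope.
Local Open Scope ring_scope.

(** The graphs are the tensor powers [K_r^(r^2)] of complete graphs: vertices
    are words of length [r^2] over [r] letters, adjacent when they differ at
    every position. Homomorphism counts and edge densities are multiplicative
    under tensor products, so the normalized [F]-density is the [r^2]-th power
    of that of [K_r], which counts proper [r]-colorings of [F]. By
    inclusion-exclusion over the sets [J] of edges of [F] that are
    monochromatic under a uniformly random coloring, and with [x = 1/r], a set
    [J] has probability [x^|J|], as if edges were independent, when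
    [|J| <= 2], probability [x^2] when [J] is a triangle, and at most [x^3]
    otherwise. Hence the density of [K_r] is [1 - triangles(F) x^2 + O(x^3)].

    If a kernel [W] existed, let [f(u,v)] be the integral of
    [W(u,t) W(v,t)] over [t]. The densities of the two-edge path and of the
    four-cycle say that [f] and [f^2] have integral 1, so [f = 1] almost
    everywhere; the triangle density, the integral of [W f], would then be
    the edge density 1. *)

(** * Tensor powers of cliques and monochromatic edge sets *)

(** Swapping the two coordinates maps [edges G] bijectively onto the adjacent ordered pairs outside
    it. *)
Lemma double_card_edges (G : sgraph) :
  (2 * #|edges G| = #|[set e : G * G | adj e.1 e.2]%SET|)%N.
Proof.
set A := [set e | _]%SET; rewrite -(cardsID (edges G) A).
have -> : (A :&: edges G = edges G)%SET.
  by apply/finset.setIidPr/fintype.subsetP => e; rewrite !inE => /andP[].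
rewrite mul2n -addnn; congr (_ + _)%N.
have swap_inj : injective (fun e : G * G => (e.2, e.1)).
  by move=> [a b] [c d] [-> ->].
rewrite -(card_imset _ swap_inj); apply: eq_card => -[a b].
apply/imsetP/idP => [[[c d]]|].
  rewrite !inE /= => /andP[cd lt] [-> ->].
  by rewrite adj_sym cd /= -leqNgt ltnW.
rewrite !inE /= => /andP[+ ab]; rewrite ab /= -leqNgt => le; exists (b, a) => //.
rewrite inE /= adj_sym ab /= ltn_neqAle.
rewrite le andbT; apply/negP => /eqP/val_inj/enum_rank_inj ba.
by move: ab; rewrite ba adj_irr.
Qed.

Section TensorClique.
Variables (k r : nat).
Local Open Scope nat_scope.

(** The word length is a successor because irreflexivity needs a position: on empty words the
    condition would hold vacuously. *)
Definition tensor_adj : rel {ffun 'I_k.+1 -> 'I_r} :=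
  fun x y => [forall i, x i != y i].

Lemma tensor_adj_sym : symmetric tensor_adj.
Proof. by move=> x y; apply: eq_forallb => i; rewrite eq_sym. Qed.

Lemma tensor_adj_irr : irreflexive tensor_adj.
Proof.
by move=> x; apply/negbTE/negP => /forallP /(_ ord0); rewrite eqxx.
Qed.

Definition tensor_clique : sgraph := SGraph tensor_adj_sym tensor_adj_irr.

Lemma card_tensor_clique : #|tensor_clique| = r ^ k.+1.
Proof. by rewrite card_ffun !card_ord. Qed.

Definition colorings (F : sgraph) : {set {ffun F -> 'I_r}} :=
  [set f : {ffun F -> 'I_r} |
    [forall u, forall v, adj u v ==> (f u != f v)]]%SET.

(** Transposing a map from vertices to words gives one map from vertices to letters for each
    position; the former is a homomorphism exactly when each of the latter is a proper coloring. *)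
Lemma card_homs_tensor_clique (F : sgraph) :
  #|homs F tensor_clique| = #|colorings F| ^ k.+1.
Proof.
pose phi (g : {ffun 'I_k.+1 -> {ffun F -> 'I_r}}) : {ffun F -> tensor_clique} :=
  [ffun v => [ffun i => g i v]].
have phi_inj : injective phi.
  move=> g h /ffunP e; apply/ffunP => i; apply/ffunP => v.
  by have /ffunP/(_ i) := e v; rewrite !ffunE.
rewrite -[X in _ = _ ^ X]card_ord -card_ffun_on -(card_imset _ phi_inj).
apply: eq_card => h; rewrite inE; apply/idP/imsetP => [/forallP hh|].
  exists [ffun i => [ffun v => h v i]].
    apply/ffun_onP => i; rewrite inE ffunE; apply/forallP => u.
    apply/forallP => v; apply/implyP => uv; rewrite !ffunE.
    by have /forallP/(_ v)/implyP/(_ uv)/forallP/(_ i) := hh u.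
  by apply/ffunP => v; apply/ffunP => i; rewrite !ffunE.
move=> [g /ffun_onP gP ->]; apply/forallP => u; apply/forallP => v.
apply/implyP => uv; apply/forallP => i; rewrite !ffunE.
by have := gP i; rewrite inE => /forallP/(_ u)/forallP/(_ v)/implyP; exact.
Qed.

(** Each of the [r ^ k.+1] words has [r.-1 ^ k.+1] neighbors, since every letter is changed
    independently. *)
Lemma card_edges_tensor_clique :
  2 * #|edges tensor_clique| = (r * r.-1) ^ k.+1.
Proof.
rewrite double_card_edges expnMn -card_tensor_clique.
rewrite -sum1_card (eq_bigl (fun e => true && adj e.1 e.2)); last first.
  by move=> e; rewrite inE.
rewrite -(pair_big_dep xpredT (fun x y : tensor_clique => adj x y) (fun _ _ => 1)).
rewrite -sum_nat_const; apply: eq_bigr => x _ /=.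
rewrite sum1_card.
have -> : #|[pred y : tensor_clique | adj x y]| =
          #|family (fun i => predC1 (x i))|.
  apply: eq_card => y; rewrite inE /=; apply/forallP/familyP => h i.
    by rewrite inE eq_sym h.
  by have := h i; rewrite inE eq_sym.
rewrite card_family /image_mem (eq_map (g := fun=> r.-1)); last first.
  by move=> i; rewrite cardC1 card_ord.
have -> (s : seq 'I_k.+1) : foldr muln 1 [seq r.-1 | _ <- s] = r.-1 ^ size s.
  by elim: s => //= _ s ->; rewrite expnS.
by rewrite -cardE card_ord.
Qed.

End TensorClique.

(** * Counting the maps that are monochromatic on a set of edges *)

Section Monochromatic.
Variables (F : sgraph) (r : nat).
Local Open Scope nat_scope.
Implicit Types (e : F * F) (J : {set F * F}) (T : {set F}).

(** Recoloring [u] arbitrarily in a map with [f u = f w] reaches every map in [Q] exactly once: the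
    lost color of [u] can be read off at [w]. *)
Lemma card_ffun_update (Q : pred {ffun F -> 'I_r}) (u w : F) : u != w ->
  (forall f g : {ffun F -> 'I_r}, (forall v, v != u -> f v = g v) -> Q f = Q g) ->
  #|[set f | Q f && (f u == f w)]%SET| * r = #|[set f | Q f]%SET|.
Proof.
move=> uw Qu; pose upd (f : {ffun F -> 'I_r}) c : {ffun F -> 'I_r} :=
  [ffun v => if v == u then c else f v].
pose A := [set f | Q f && (f u == f w)]%SET.
have Qupd f c : Q (upd f c) = Q f.
  by apply: Qu => v vu; rewrite ffunE (negbTE vu).
rewrite -[X in _ * X]card_ord -cardsT -cardsX -/A.
rewrite -(@card_in_imset _ _ (fun p => upd p.1 p.2)).
  apply: eq_card => g; rewrite !inE; apply/imsetP/idP => [[[f c]]|Qg].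
    by rewrite !inE /= => /andP[/andP[Qf _] _] ->; rewrite Qupd.
  exists (upd g (g w), g u).
    by rewrite !inE /= Qupd Qg !ffunE eqxx [w == u]eq_sym (negbTE uw) eqxx.
  by apply/ffunP => v; rewrite !ffunE; case: eqP => // ->.
move=> [f c] [g d] /=; rewrite !inE !andbT /=.
move=> /andP[_ /eqP fuw] /andP[_ /eqP guw] /ffunP e.
have E v : v != u -> f v = g v.
  by move=> vu; have := e v; rewrite !ffunE (negbTE vu).
have := e u; rewrite !ffunE eqxx => ->; congr (_, _); apply/ffunP => v.
have [->|/E //] := eqVneq v u; rewrite fuw guw E // eq_sym.
by rewrite uw.
Qed.

Definition ends e : {set F} := [set e.1; e.2]%SET.

Definition span_vertices J : {set F} := (\bigcup_(e in J) ends e)%SET.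

Definition monochromatic J : {set {ffun F -> 'I_r}} :=
  [set f : {ffun F -> 'I_r} | [forall e in J, f e.1 == f e.2]]%SET.

Lemma monochromaticS J J' :
  J \subset J' -> #|monochromatic J'| <= #|monochromatic J|.
Proof.
move=> /fintype.subsetP JJ'; apply/subset_leq_card/fintype.subsetP => f.
rewrite !inE => /forall_inP h; apply/forall_inP => e /JJ'; exact: h.
Qed.

Lemma card_monochromatic0 : #|monochromatic finset.set0| = r ^ #|F|.
Proof.
rewrite -[in RHS](card_ord r) -card_ffun -cardsT; apply: eq_card => f.
by rewrite !inE; apply/forall_inP => e; rewrite inE.
Qed.

Lemma edge_neq e : e \in edges F -> e.1 != e.2.
Proof.
by rewrite inE => /andP[a _]; apply/eqP => E; move: a; rewrite E adj_irr.
Qed.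

(** An endpoint of [e] that no edge of [J] touches has a free color, so making [e] monochromatic
    costs a factor of exactly [r]. *)
Lemma card_monochromaticU1 J e : e \in edges F ->
  ~~ (ends e \subset span_vertices J) ->
  #|monochromatic (e |: J)%SET| * r = #|monochromatic J|.
Proof.
move=> eF /subsetPn[u]; rewrite !inE => ue uJ.
have [w uw wE] : exists2 w, u != w & forall f : {ffun F -> 'I_r},
    (f e.1 == f e.2) = (f u == f w).
  have := edge_neq eF; case/orP: ue => /eqP ->; first by exists e.2.
  by exists e.1 => [|f]; rewrite eq_sym.
pose Q (f : {ffun F -> 'I_r}) := [forall e in J, f e.1 == f e.2].
rewrite -(@card_ffun_update Q u w) //.
  congr (_ * _); apply: eq_card => f; rewrite !inE -wE.
  apply/forall_inP/andP => [h|[/forall_inP h he] e'].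
    split; last by apply: h; rewrite setU11.
    by apply/forall_inP => e' e'J; apply: h; rewrite setU1r.
  by rewrite !inE => /orP[/eqP -> //|]; exact: h.
move=> f g fg; apply: eq_forallb => e'; case e'J: (e' \in J) => //=.
have ne z : z \in ends e' -> z != u.
  move=> zE; apply: contraNneq uJ => <-; apply/bigcupP; by exists e'.
by rewrite !fg //; apply: ne; rewrite !inE eqxx ?orbT.
Qed.

Lemma card_ends e : e \in edges F -> #|ends e| = 2.
Proof. by move=> /edge_neq ne; rewrite cards2 ne. Qed.

Lemma ends_inj : {in edges F &, injective ends}.
Proof.
move=> [a b] [c d]; rewrite !inE /= => /andP[ab lab] /andP[cd lcd] /setP E.
have := E a; have := E b; rewrite !inE !eqxx /= orbT.
move=> /esym/orP[]/eqP Eb /esym/orP[]/eqP Ea; rewrite ?Ea ?Eb //.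
- by move: ab; rewrite Ea Eb adj_irr.
- by move: lab; rewrite Ea Eb ltnNge ltnW.
- by move: ab; rewrite Ea Eb adj_irr.
Qed.

Definition inner_edges T : {set F * F} := [set e in edges F | ends e \subset T]%SET.

Lemma in_inner_edges T e :
  (e \in inner_edges T) = (e \in edges F) && (ends e \subset T).
Proof. by rewrite finset.in_set. Qed.

Lemma inner_edges_sub T : ends @: inner_edges T \subset
  [set B : {set F} | B \subset T & #|B| == 2]%SET.
Proof.
apply/fintype.subsetP => _ /imsetP[e + ->]; rewrite in_inner_edges => /andP[eF eT].
by rewrite inE eT card_ends.
Qed.

Lemma card_inner_edges T : #|ends @: inner_edges T| = #|inner_edges T|.
Proof.
apply: card_in_imset => e e'; rewrite in_inner_edges => /andP[eF _].
by rewrite in_inner_edges => /andP[e'F _]; exact: ends_inj.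
Qed.

Lemma adj_edge u v : adj u v -> exists2 e, e \in edges F & ends e = [set u; v]%SET.
Proof.
move=> uv; case: (ltngtP (enum_rank u) (enum_rank v)) => [lt|lt|/val_inj].
- by exists (u, v); rewrite ?inE /= ?uv.
- by exists (v, u); rewrite ?inE /= ?[adj v u]adj_sym ?uv // /ends /= finset.setUC.
- by move/enum_rank_inj => E; move: uv; rewrite E adj_irr.
Qed.

Lemma trianglesP T : T \in triangles F ->
  #|T| = 3 /\ {in T &, forall u v, u != v -> adj u v}.
Proof.
rewrite inE => /andP[/eqP T3 /forall_inP h]; split => // u v uT vT uv.
by have /forall_inP/(_ v vT)/implyP := h u uT; apply.
Qed.

Lemma inner_edges_triangle T : T \in triangles F ->
  ends @: inner_edges T = [set B : {set F} | B \subset T & #|B| == 2]%SET.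
Proof.
move=> /trianglesP[T3 Tadj]; apply/eqP; rewrite finset.eqEsubset inner_edges_sub /=.
apply/fintype.subsetP => B; rewrite inE => /andP[BT /cards2P[u [v [uv BE]]]].
have [uT vT] : u \in T /\ v \in T.
  by split; apply: (fintype.subsetP BT); rewrite BE !inE eqxx ?orbT.
have [e eF eE] := adj_edge (Tadj _ _ uT vT uv).
by apply/imsetP; exists e; rewrite ?in_inner_edges ?eF eE -BE.
Qed.

Lemma card_inner_edges_triangle T : T \in triangles F -> #|inner_edges T| = 3.
Proof.
move=> TT; rewrite -card_inner_edges inner_edges_triangle // cards_draws.
by case: (trianglesP TT) => ->.
Qed.

(** Every vertex of a triangle lies on one of its edges, so the edge set determines the triangle.
    This allows triangles to be counted by their edge sets. *)
Lemma inner_edges_inj : {in triangles F &, injective inner_edges}.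
Proof.
move=> T T' tT tT' E; apply/eqP; rewrite eqEcard.
case: (trianglesP tT) => T3 _; case: (trianglesP tT') => T'3 _.
rewrite T3 T'3 leqnn andbT; apply/fintype.subsetP => u uT.
have /card_gt0P[v] : 0 < #|T :\ u|.
  by move: (cardsD1 u T); rewrite uT T3 add1n => -[<-].
rewrite !inE => /andP[vu vT].
have : [set u; v]%SET \in ends @: inner_edges T'.
  rewrite -E inner_edges_triangle // inE cards2 [u == v]eq_sym vu andbT.
  by apply/fintype.subsetP => z; rewrite !inE => /orP[]/eqP ->.
move=> /imsetP[e]; rewrite in_inner_edges => /andP[_ /fintype.subsetP eT'] eE.
by apply: eT'; rewrite -eE !inE eqxx.
Qed.

Lemma ends_neq e1 e2 : e1 \in edges F -> e2 \in edges F -> e1 != e2 ->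
  ~~ (ends e1 \subset ends e2).
Proof.
move=> e1F e2F; apply: contra => sub; apply/eqP/ends_inj => //.
by apply/eqP; rewrite eqEcard sub !card_ends.
Qed.

Lemma span_verticesU1 e J :
  span_vertices (e |: J)%SET = (ends e :|: span_vertices J)%SET.
Proof. by rewrite /span_vertices finset.bigcup_setU big_set1. Qed.

Lemma card_monochromatic1 e : e \in edges F ->
  #|monochromatic [set e]%SET| * r = r ^ #|F|.
Proof.
move=> eF; rewrite -[[set e]%SET]finset.setU0 card_monochromaticU1 //.
  exact: card_monochromatic0.
by rewrite /span_vertices big_set0 finset.subset0 -cards_eq0 card_ends.
Qed.

Lemma card_monochromatic2 e1 e2 : e1 \in edges F -> e2 \in edges F -> e1 != e2 ->
  #|monochromatic [set e1; e2]%SET| * r ^ 2 = r ^ #|F|.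
Proof.
move=> e1F e2F e12; rewrite expnS expn1 mulnA card_monochromaticU1 //.
  exact: card_monochromatic1.
by rewrite /span_vertices big_set1 ends_neq.
Qed.

Lemma card_monochromatic3 e1 e2 e3 :
  e1 \in edges F -> e2 \in edges F -> e3 \in edges F -> e1 != e2 ->
  ~~ (ends e3 \subset ends e1 :|: ends e2)%SET ->
  #|monochromatic (e3 |: [set e1; e2])%SET| * r ^ 3 = r ^ #|F|.
Proof.
move=> e1F e2F e3F e12 e3n; rewrite expnS mulnA card_monochromaticU1 //.
  exact: card_monochromatic2.
by rewrite span_verticesU1 /span_vertices big_set1.
Qed.

Lemma card_monochromatic_small J : J \subset edges F -> #|J| <= 2 ->
  #|monochromatic J| * r ^ #|J| = r ^ #|F|.
Proof.
move=> /fintype.subsetP JF; case E: #|J| => [|[|[|//]]] _.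
- by rewrite (cards0_eq E) card_monochromatic0 muln1.
- move/eqP: E => /cards1P[e JE]; rewrite JE in JF *.
  by rewrite expn1 card_monochromatic1 // JF // inE.
- move/eqP: E => /cards2P[e1 [e2 [e12 JE]]]; rewrite JE in JF *.
  by rewrite card_monochromatic2 // JF // !inE eqxx ?orbT.
Qed.

Lemma card_ends_union e1 e2 : e1 \in edges F -> e2 \in edges F ->
  #|(ends e1 :|: ends e2)%SET| + #|(ends e1 :&: ends e2)%SET| = 4.
Proof. by move=> e1F e2F; rewrite cardsUI !card_ends. Qed.

(** Two edges of a triangle share a vertex and cover all three, so once both are monochromatic the
    third is as well, and the count is that for two edges. *)
Lemma card_monochromatic_triangle T : T \in triangles F ->
  #|monochromatic (inner_edges T)| * r ^ 2 = r ^ #|F|.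
Proof.
move=> TF; have /card_gt1P[e1 [e2 [e1T e2T e12]]] : 1 < #|inner_edges T|.
  by rewrite card_inner_edges_triangle.
move: (e1T) (e2T); rewrite !in_inner_edges => /andP[e1F s1] /andP[e2F s2].
rewrite -(card_monochromatic2 e1F e2F e12); congr (_ * _).
apply/eqP; rewrite eqn_leq monochromaticS /=; last first.
  by apply/fintype.subsetP => e; rewrite finset.in_set2 => /orP[]/eqP ->.
apply/subset_leq_card/fintype.subsetP => f.
rewrite !inE => /forall_inP fP.
have f1 : f e1.1 = f e1.2 by apply/eqP/fP; rewrite !inE eqxx.
have f2 : f e2.1 = f e2.2 by apply/eqP/fP; rewrite !inE eqxx orbT.
have sub : (ends e1 :|: ends e2)%SET \subset T by rewrite finset.subUset s1.
have [T3 _] := trianglesP TF.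
have ltU : 2 < #|(ends e1 :|: ends e2)%SET|.
  rewrite -(card_ends e2F); apply: proper_card.
  by rewrite properE finset.subsetUr finset.subUset subxx andbT ends_neq.
have TE : T = (ends e1 :|: ends e2)%SET.
  by apply/esym/eqP; rewrite eqEcard sub T3.
have := card_ends_union e1F e2F; rewrite -TE T3 -[4]/(3 + 1) => /addnI I1.
have /card_gt0P[z] : 0 < #|(ends e1 :&: ends e2)%SET| by rewrite I1.
rewrite finset.in_setI => /andP[z1 z2].
have fends e u : f e.1 = f e.2 -> u \in ends e -> f u = f e.1.
  by move=> fe; rewrite finset.in_set2 => /orP[]/eqP ->.
have const u : u \in T -> f u = f z.
  rewrite TE finset.in_setU => /orP[] ue.
    by rewrite (fends e1 u) // (fends e1 z).
  by rewrite (fends e2 u) // (fends e2 z).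
apply/forall_inP => e; rewrite in_inner_edges => /andP[_ /fintype.subsetP eT].
by rewrite !const //; apply: eT; rewrite !inE eqxx ?orbT.
Qed.

(** It suffices to find three edges in [J], the last of which leaves the vertex set of the first
    two: each then contributes a factor [r]. If there are none, [J] is the edge set of a
    triangle. *)
Lemma card_monochromatic_other J : J \subset edges F -> 2 < #|J| ->
  J \notin inner_edges @: triangles F ->
  #|monochromatic J| * r ^ 3 <= r ^ #|F|.
Proof.
move=> /fintype.subsetP JF J3 Jtri.
suff [e1 [e2 [e3 [e1J e2J e3J e12 e3n]]]] : exists e1 e2 e3,
    [/\ e1 \in J, e2 \in J, e3 \in J, e1 != e2 &
     ~~ (ends e3 \subset ends e1 :|: ends e2)%SET].
  rewrite -(@card_monochromatic3 e1 e2 e3) ?JF // leq_mul2r monochromaticS ?orbT //.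
  by apply/fintype.subsetP => e; rewrite !inE => /orP[/eqP->|/orP[]/eqP->].
have /card_gt1P[e1 [e2 [e1J e2J e12]]] : 1 < #|J| by exact: ltnW.
set T := (ends e1 :|: ends e2)%SET.
have [/exists_inP[e3 e3J e3n]|/exists_inPn noe3] :=
    boolP [exists e3 in J, ~~ (ends e3 \subset T)].
  by exists e1, e2, e3.
have JT e : e \in J -> ends e \subset T by move=> /noe3; rewrite negbK.
(* If [e1] and [e2] are disjoint, any further edge [e3] lies across them, and [e2] leaves the vertex
   set of [e1] and [e3]: otherwise [e3] and [e2] would both be the complement of [e1] in [T]. *)
have [T4|Tn4] := eqVneq #|T| 4.
  have /card_gt0P[e3] : 0 < #|J :\: [set e1; e2]|%SET.
    rewrite cardsD subn_gt0 (leq_ltn_trans _ J3) //.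
    rewrite (leq_trans (subset_leq_card (finset.subsetIr _ _))) // cards2.
    by case: (e1 != e2).
  rewrite !inE negb_or -andbA => /and3P[e31 e32 e3J].
  exists e1, e3, e2; split => //; first by rewrite eq_sym.
  apply/negP => e2s.
  have TE : T = (ends e1 :|: ends e3)%SET.
    apply/eqP; rewrite finset.eqEsubset; apply/andP; split; apply/finset.subUsetP.
      by rewrite finset.subsetUl.
    by rewrite finset.subsetUl JT.
  have dis e : e \in J -> #|(ends e1 :|: ends e)%SET| = 4 ->
      ends e = ((ends e1 :|: ends e) :\: ends e1)%SET.
    move=> eJ U4; have := card_ends_union (JF _ e1J) (JF _ eJ).
    rewrite U4 -[X in _ = X]addn0 => /addnI/cards0_eq I0.
    rewrite finset.setDUl finset.setDv finset.set0U; apply/esym/finset.setDidPl.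
    by rewrite -setI_eq0 finset.setIC I0.
  have := ends_neq (JF _ e3J) (JF _ e2J) e32.
  by rewrite (dis e3) // -?TE // (dis e2) // subxx.
have JinT : J \subset inner_edges T.
  by apply/fintype.subsetP => e eJ; rewrite in_inner_edges JF // JT.
have ltU : 2 < #|T|.
  rewrite -(card_ends (JF _ e2J)); apply: proper_card.
  by rewrite properE finset.subsetUr finset.subUset subxx andbT ends_neq // JF.
(* Now [J] has at least three edges inside the three-element set [T], which has only three pairs;
   hence all pairs are edges and [J] consists of them. *)
have T3 : #|T| = 3.
  have := card_ends_union (JF _ e1J) (JF _ e2J); rewrite -/T => U.
  apply/eqP; rewrite eqn_leq ltU andbT -ltnS ltn_neqAle Tn4 /=.
  by rewrite -U leq_addr.
have draws3 : #|[set B : {set F} | B \subset T & #|B| == 2]%SET| = 3.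
  by rewrite cards_draws T3.
have E3 : 3 <= #|inner_edges T| by rewrite (leq_trans J3) // subset_leq_card.
have TE : ends @: inner_edges T =
    [set B : {set F} | B \subset T & #|B| == 2]%SET.
  by apply/eqP; rewrite eqEcard inner_edges_sub draws3 card_inner_edges.
case/negP: Jtri; apply/imsetP; exists T.
  rewrite inE T3 eqxx; apply/forall_inP => u uT; apply/forall_inP => v vT.
  apply/implyP => uv.
  have : [set u; v]%SET \in ends @: inner_edges T.
    rewrite TE inE cards2 uv andbT.
    by apply/fintype.subsetP => z; rewrite finset.in_set2 => /orP[]/eqP ->.
  move=> /imsetP[e]; rewrite in_inner_edges => /andP[+ _] /setP eE.
  rewrite inE => /andP[+ _].
  have := eE u; have := eE v; rewrite !inE !eqxx /= orbT.
  move=> /esym/orP[]/eqP Ev /esym/orP[]/eqP Eu.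
  - by rewrite Ev Eu eqxx in uv.
  - by rewrite adj_sym Ev Eu.
  - by rewrite Ev Eu.
  - by rewrite Ev Eu eqxx in uv.
apply/eqP; rewrite eqEcard JinT (leq_trans _ J3) //.
by rewrite -card_inner_edges TE draws3.
Qed.

End Monochromatic.

(** * The coloring expansion *)

Lemma prod_1B (R : comNzRingType) (I : finType) (E : {set I}) (y : I -> R) :
  \prod_(i in E) (1 - y i) =
  \sum_(J : {set I} | J \subset E) (-1) ^+ #|J| * \prod_(i in J) y i.
Proof.
rewrite big_mkcond.
(* Factors outside [E] are written as [0 + 1], so the product can be expanded over all subsets and
   those not inside [E] contribute zero. *)
rewrite (eq_bigr (fun i => (if i \in E then - y i else 0) + 1)); last first.
  by move=> i _; case: ifP => _; rewrite ?add0r // addrC.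
rewrite bigA_distr [RHS]big_mkcond; apply: eq_big => // J _.
rewrite -big_mkcond /=; case: ifPn => [/fintype.subsetP JE|/subsetPn[i iJ iE]].
  rewrite -prodr_const -big_split; apply: eq_bigr => i /JE /= ->.
  by rewrite mulN1r.
by rewrite (bigD1 i) //= (negbTE iE) mul0r.
Qed.

Section ColoringExpansion.
Variables (R : realType) (F : sgraph) (r : nat).

Lemma coloringsP (f : {ffun F -> 'I_r}) :
  (f \in colorings r F) = [forall e in edges F, f e.1 != f e.2].
Proof.
rewrite inE; apply/forallP/forall_inP => [h e|h u].
  by rewrite inE => /andP[a _]; have /forallP/(_ e.2)/implyP := h e.1; apply.
apply/forallP => v; apply/implyP => uv.
have [e eF /setP eE] := adj_edge uv; have := h e eF; apply: contra => /eqP fuv.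
have fz z : z \in ends e -> f z = f u.
  by rewrite eE finset.in_set2 => /orP[]/eqP ->.
by rewrite !fz // !inE eqxx ?orbT.
Qed.

(** Inclusion-exclusion: the indicator of a proper coloring is the product over the edges of one
    minus the indicator that the edge is monochromatic. *)
Lemma card_coloringsE :
  #|colorings r F|%:R = \sum_(J : {set F * F} | J \subset edges F)
    (-1) ^+ #|J| * #|monochromatic r J|%:R :> R.
Proof.
have prodb (I : finType) (A : {set I}) (b : I -> bool) :
    \prod_(i in A) (b i)%:R = ([forall i in A, b i])%:R :> R.
  case: (boolP [forall _ in _, _]) => [/forall_inP h|/forall_inPn[i iA /negbTE bi]].
    by rewrite big1 // => i iA; rewrite h.
  by rewrite (bigD1 i) //= bi mul0r.
have monoE J : #|monochromatic r J|%:R =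
    \sum_(f : {ffun F -> 'I_r}) \prod_(e in J) (f e.1 == f e.2)%:R :> R.
  rewrite -sum1_card natr_sum big_mkcond; apply: eq_bigr => f _.
  by rewrite prodb inE; case: [forall _ in _, _].
under eq_bigr do rewrite monoE mulr_sumr.
rewrite exchange_big /= -sum1_card natr_sum big_mkcond.
apply: eq_bigr => f _; rewrite -prod_1B coloringsP.
rewrite (_ : (if _ then _ else _) = ([forall e in edges F, f e.1 != f e.2])%:R);
  last by case: [forall _ in _, _].
rewrite -prodb; apply: eq_bigr => e _.
by case: eqP; rewrite ?subrr ?subr0.
Qed.

(** The power [(1 - r%:R^-1) ^+ #|edges F|] expands into the same alternating sum with independent
    edges, so the two are compared term by term. Each term is off by at most the cube of [r%:R^-1]
    once the triangles are corrected, and there are at most [#|{set F * F}|] terms. *)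
Lemma coloring_expansion : (0 < r)%N ->
  `| #|colorings r F|%:R / r%:R ^+ #|F| - (1 - r%:R^-1) ^+ #|edges F| +
     #|triangles F|%:R * r%:R^-1 ^+ 2 | <= #|{set F * F}|%:R * r%:R^-1 ^+ 3 :> R.
Proof.
move=> r0; set x := (r%:R^-1 : R).
have rR0 : (r%:R : R) != 0 by rewrite pnatr_eq0 -lt0n.
have x0 : 0 <= x by rewrite invr_ge0 ler0n.
have x1 : x <= 1 by rewrite invf_le1 ?ltr0n // ler1n.
pose img := (@inner_edges F @: triangles F)%SET.
pose w (J : {set F * F}) : R := #|monochromatic r J|%:R / r%:R ^+ #|F|.
have imgE J : J \in img -> (J \subset edges F) /\ #|J| = 3%N.
  move=> /imsetP[T TT ->]; rewrite card_inner_edges_triangle //; split => //.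
  by apply/fintype.subsetP => e; rewrite in_inner_edges => /andP[].
have wE (J : {set F * F}) j :
    (#|monochromatic r J| * r ^ j = r ^ #|F|)%N -> w J = x ^+ j.
  move=> /(congr1 (GRing.natmul (1 : R))); rewrite natrM !natrX => E.
  have -> : w J = (r%:R ^+ #|F| / r%:R ^+ j) / r%:R ^+ #|F|.
    by rewrite /w; congr (_ / _); rewrite -E mulfK ?expf_neq0.
  by rewrite mulrAC divff ?expf_neq0 // mul1r /x exprVn.
have -> : #|colorings r F|%:R / r%:R ^+ #|F| - (1 - x) ^+ #|edges F| +
     #|triangles F|%:R * x ^+ 2 = \sum_(J : {set F * F} | J \subset edges F)
     ((-1) ^+ #|J| * (w J - x ^+ #|J|) + (if J \in img then x ^+ 2 else 0)).
  rewrite big_split /=; congr (_ + _).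
    rewrite -(prodr_const (mem (edges F)) (1 - x)) prod_1B card_coloringsE.
    rewrite mulr_suml -sumrB.
    by apply: eq_bigr => J _; rewrite prodr_const mulrBr /w mulrA.
  rewrite -(card_in_imset (@inner_edges_inj F)) -/img.
  rewrite -big_mkcondr (eq_bigl (mem img)); last first.
    by move=> J /=; apply/andb_idl => /imgE[].
  by rewrite sumr_const mulr_natl.
apply: le_trans (ler_norm_sum _ _ _) _.
rewrite mulr_natl -sumr_const [X in _ <= X]big_mkcond /= [X in X <= _]big_mkcond /=.
apply: ler_sum => J _.
have x30 : 0 <= x ^+ 3 by rewrite exprn_ge0.
case: ifP => // JF.
have [J2|J3] := leqP #|J| 2.
  rewrite (wE J _ (card_monochromatic_small _ JF J2)) subrr mulr0 add0r.
  by case: ifP => [/imgE[_ E]|_]; [rewrite E in J2|rewrite normr0].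
case: ifPn => Ji.
  have [_ ->] := imgE _ Ji; case/imsetP: Ji => T TT ->.
  rewrite (wE _ 2%N (card_monochromatic_triangle _ TT)).
  (* For the three edges of a triangle the term is [-(x^2 - x^3) + x^2]. *)
  rewrite (_ : _ + _ = x ^+ 3); last by ring.
  by rewrite ger0_norm.
rewrite addr0 normrM normrX normrN1 expr1n mul1r.
(* Both [w J] and [x ^+ #|J|] lie between 0 and [x ^+ 3], hence so does the absolute value of their
   difference. *)
have w3 : w J <= x ^+ 3.
  rewrite /w ler_pdivrMr ?exprn_gt0 ?ltr0n // /x exprVn mulrC.
  rewrite ler_pdivlMr ?exprn_gt0 ?ltr0n //.
  by rewrite -!natrX -natrM ler_nat card_monochromatic_other.
have w0 : 0 <= w J by rewrite divr_ge0 ?exprn_ge0 ?ler0n.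
have xJ : x ^+ #|J| <= x ^+ 3 by rewrite ler_wiXn2l.
have xJ0 : 0 <= x ^+ #|J| by rewrite exprn_ge0.
rewrite ler_norml; apply/andP; split; lra.
Qed.

End ColoringExpansion.

(** * Limits *)

(* Squeeze between the exponentials given by [1 - 1 / u <= ln u <= u - 1]. *)
Lemma cvg_expn_expR (R : realType) (u : nat -> R) (k : nat -> nat) (l : R) :
  u n @[n --> \oo] --> (1 : R) -> (k n)%:R * (u n - 1) @[n --> \oo] --> l ->
  u n ^+ k n @[n --> \oo] --> expR l.
Proof.
move=> u1 kl.
have u0 : \forall n \near \oo, 0 < u n.
  by move/cvgrPdist_lt : u1 => /(_ 1 ltr01); apply: filterS => n;
    rewrite ltr_norml => /andP[]; lra.
apply: (@squeeze_cvgr _ _ _ _ (fun n => expR ((k n)%:R * (u n - 1) / u n))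
    (fun n => expR ((k n)%:R * (u n - 1)))).
- apply: filterS u0 => n u0; apply/andP; split.
    rewrite -mulrA expRM_natl lerXn2r ?nnegrE ?expR_ge0 ?(ltW u0) //.
    have -> : (u n - 1) / u n = - ((u n)^-1 - 1) by field; exact: lt0r_neq0.
    rewrite expRN invf_ple ?posrE ?expR_gt0 //.
    by apply: le_trans (expR_ge1Dx _); rewrite addrC subrK.
  rewrite expRM_natl lerXn2r ?nnegrE ?expR_ge0 ?(ltW u0) //.
  by apply: le_trans (expR_ge1Dx _); rewrite addrC subrK.
- apply: continuous_cvg; first exact: continuous_expR.
  rewrite -[X in _ --> X]mulr1 -[X in _ * X]invr1; apply: cvgM => //.
  by apply: cvgV; rewrite ?oner_neq0.
- by apply: continuous_cvg => //; exact: continuous_expR.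
Qed.

Section Limit.
Variable R : realType.
Let x n : R := n.+2%:R^-1.

Lemma cvg_invS2 : n.+2%:R^-1 @[n --> \oo] --> (0 : R).
Proof.
have h := @cvg_harmonic R; rewrite -cvg_shiftS in h; exact: h.
Qed.

(** By [coloring_expansion] the ratio is [1 - #|triangles F| x^2 + O(x^3)] with [x] the inverse of
    [n.+2]; the exponent is exactly [x^-2], so [cvg_expn_expR] applies. *)
Lemma coloring_ratio_cvg (F : sgraph) :
  ((#|colorings n.+2 F|%:R / n.+2%:R ^+ #|F|) / (1 - n.+2%:R^-1) ^+ #|edges F|)
    ^+ (n.+2 ^ 2)%N @[n --> \oo] --> expR (- #|triangles F|%:R : R).
Proof.
pose T n : R := #|colorings n.+2 F|%:R / n.+2%:R ^+ #|F|.
pose q n : R := (1 - x n) ^+ #|edges F|.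
have x_cvg : x n @[n --> \oo] --> (0 : R) by exact: cvg_invS2.
have x_gt0 n : 0 < x n by rewrite invr_gt0 ltr0n.
have q0 n : q n != 0.
  rewrite expf_neq0 // subr_eq0 eq_sym lt_eqF //.
  by rewrite /x invf_lt1 ?ltr0n // ltr1n.
have q_cvg : q n @[n --> \oo] --> (1 : R).
  have h : (1 - x n) @[n --> \oo] --> (1 : R).
    by rewrite -[X in _ --> X]subr0; apply: cvgB => //; exact: cvg_cst.
  have := continuous_cvg _ (@exprn_continuous R #|edges F| 1) h.
  by rewrite /= expr1n => H; exact: H.
pose C : R := #|{set F * F}|%:R; pose tF : R := #|triangles F|%:R.
have d_cvg : (T n - q n) / x n ^+ 2 @[n --> \oo] --> - tF.
  have side (s : R) : - tF + s * x n @[n --> \oo] --> - tF.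
    rewrite -[X in _ --> X]addr0 -[X in _ + X](mulr0 s).
    by apply: cvgD; [exact: cvg_cst|apply: cvgM => //; exact: cvg_cst].
  apply: squeeze_cvgr (side (- C)) (side C); apply: nearW => n.
  have := @coloring_expansion R F n.+2 isT; rewrite -/(x n) -/(T n) -/(q n).
  rewrite -/C -/tF ler_norml => /andP[lo hi].
  rewrite ler_pdivlMr ?ler_pdivrMr ?exprn_gt0 //.
  by apply/andP; split; [move: lo|move: hi]; rewrite !exprS !expr0; lra.
have rx n : n.+2%:R = (x n)^-1 by rewrite /x invrK.
have kE n : (n.+2 ^ 2)%N%:R * (T n / q n - 1) = (T n - q n) / x n ^+ 2 / q n.
  by rewrite natrX rx; field; rewrite q0 lt0r_neq0.
apply: (@cvg_expn_expR R (fun n => T n / q n)); last first.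
  rewrite (_ : (fun n => _) = (fun n => (T n - q n) / x n ^+ 2 / q n));
    last exact/funext.
  rewrite -[X in _ --> X]mulr1 -[X in _ * X]invr1; apply: cvgM => //.
  by apply: cvgV; rewrite ?oner_neq0.
(* The ratio tends to 1 because its distance from 1 is a convergent sequence times [x n * x n]. *)
have -> : (fun n => T n / q n) =
    (fun n => 1 + (T n - q n) / x n ^+ 2 / q n * (x n * x n)).
  by apply/funext => n; field; rewrite q0 lt0r_neq0.
rewrite -[X in _ --> X]addr0; apply: cvgD; first exact: cvg_cst.
rewrite -[X in _ --> X](mulr0 (- tF / 1)); apply: cvgM.
  by apply: cvgM => //; apply: cvgV; rewrite ?oner_neq0.
by rewrite -[X in _ --> X](mulr0 0); apply: cvgM.
Qed.

(** * Densities of the tensor powers *)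

Lemma edge_density_tensor_clique k r :
  edge_density R (tensor_clique k r.+1) = (1 - r.+1%:R^-1) ^+ k.+1.
Proof.
rewrite /edge_density -natrM card_edges_tensor_clique card_tensor_clique.
rewrite !natrX natrM exprMn -exprMn -!exprM mulnC exprM -expr_div_n; congr (_ ^+ _).
have r0 : (r.+1%:R : R) != 0 by rewrite pnatr_eq0.
have -> : r.+1.-1%:R = r.+1%:R - 1 :> R by rewrite -natr1 addrK.
by field.
Qed.

Lemma normalized_density_tensor_clique (F : sgraph) k r :
  normalized_density (edge_density R (tensor_clique k r.+1)) F
    (tensor_clique k r.+1) =
  ((#|colorings r.+1 F|%:R / r.+1%:R ^+ #|F|) /
    (1 - r.+1%:R^-1) ^+ #|edges F|) ^+ k.+1.
Proof.
rewrite /normalized_density edge_density_tensor_clique card_homs_tensor_clique.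
rewrite card_tensor_clique !natrX !expr_div_n invfM -!exprM.
rewrite [(k.+1 * _)%N in X in _ * (X^-1 * _)]mulnC [(k.+1 * #|F|)%N]mulnC.
by rewrite mulrA mulrAC.
Qed.

(** This is the exponent [eps] for which the edge density is [|G|^(-eps)]: the word length cancels
    between the two logarithms. The numerator is at most [2 * x n] since [x n <= 1/2], and the
    denominator is at least [ln 2]. *)
Lemma cvg_density_exponent :
  - ln (1 - n.+2%:R^-1) / ln n.+2%:R @[n --> \oo] --> (0 : R).
Proof.
have x_gt0 n : 0 < x n by rewrite invr_gt0 ltr0n.
have x_lt1 n : x n < 1 by rewrite /x invf_lt1 ?ltr0n // ltr1n.
have x_le n : x n <= 2^-1 by rewrite /x lef_pV2 ?posrE ?ltr0n // ler_nat.
have ln2 : 0 < ln (2 : R) by rewrite ln_gt0 // ltr1n.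
have lnr n : ln (2 : R) <= ln n.+2%:R.
  by rewrite ler_ln ?posrE ?ltr0n // ler_nat.
apply: (@squeeze_cvgr _ _ _ _ (fun=> 0) (fun n => 2 * x n * (ln 2)^-1)).
- apply: nearW => n; rewrite -/(x n).
  have y0 : 0 < 1 - x n by rewrite subr_gt0.
  rewrite -lnV ?posrE //.
  have l0 : 0 <= ln (1 - x n)^-1.
    by rewrite ln_ge0 // invf_ge1 // gerBl ltW.
  have l1 : ln (1 - x n)^-1 <= 2 * x n.
    apply: (@le_trans _ _ ((1 - x n)^-1 - 1)).
      rewrite -[X in ln X](subrK 1) addrC; apply: le_ln1Dx.
      by rewrite ltrBrDr addNr invr_gt0.
    rewrite lerBlDr -[X in X <= _]mul1r ler_pdivrMr //.
    have := x_le n; have := x_gt0 n; nra.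
  rewrite divr_ge0 //=; last exact: le_trans (ltW ln2) (lnr n).
  apply: ler_pM => //; first by rewrite invr_ge0 (le_trans (ltW ln2)).
  by rewrite lef_pV2 ?posrE ?(lt_le_trans ln2).
- exact: cvg_cst.
- rewrite -[X in _ --> X](mul0r (ln 2)^-1) -[X in X * _](mulr0 2).
  apply: cvgM; last exact: cvg_cst.
  by apply: cvgM; [exact: cvg_cst|exact: cvg_invS2].
Qed.

End Limit.

Lemma sparse_limit_sequence (R : realType) : exists G : nat -> sgraph,
    [/\ #|G n| @[n --> \oo] --> \oo,
        forall n, 0 < edge_density R (G n),
        exists2 eps : nat -> R, eps n @[n --> \oo] --> (0 : R) &
          forall n, edge_density R (G n) = #|G n|%:R `^ (- eps n) &
        forall F : sgraph,
          normalized_density (edge_density R (G n)) F (G n) @[n --> \oo]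
            --> expR (- #|triangles F|%:R : R)].
Proof.
(* The predecessor offsets the successor in the word length. The alphabet has [n.+2] letters, so
   that the density and the logarithm of the alphabet size are positive. *)
pose k n := (n.+2 ^ 2).-1%N.
have kE n : (k n).+1 = (n.+2 ^ 2)%N by rewrite prednK // expn_gt0.
have pos n : 0 < 1 - n.+2%:R^-1 :> R.
  by rewrite subr_gt0 invf_lt1 ?ltr0n // ltr1n.
have rpos n : 0 < n.+2%:R :> R by rewrite ltr0n.
have lnpos n : 0 < ln n.+2%:R :> R by rewrite ln_gt0 // ltr1n.
exists (fun n => tensor_clique (k n) n.+2); split.
- apply/cvgnyPge => A; near=> n; rewrite card_tensor_clique.
  have : (A <= n)%N by near: n; exact: nbhs_infty_ge.
  move=> /leq_trans; apply; apply: leq_trans (_ : n.+2 <= _)%N => //.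
    by rewrite ltnW.
  by rewrite expnS leq_pmulr // expn_gt0.
- by move=> n; rewrite edge_density_tensor_clique exprn_gt0.
- exists (fun n => - ln (1 - n.+2%:R^-1) / ln n.+2%:R).
    exact: cvg_density_exponent.
  move=> n; rewrite edge_density_tensor_clique card_tensor_clique natrX.
  rewrite /powR gt_eqF ?exprn_gt0 // lnXn // mulrnAr !mulNr opprK divfK ?gt_eqF //.
  by rewrite -[X in expR X]mulr_natl expRM_natl lnK ?posrE.
- move=> F; under eq_fun do rewrite normalized_density_tensor_clique kE.
  exact: coloring_ratio_cvg.
Unshelve. all: end_near.
Qed.

(** * Kernels *)

Section IteratedIntegral.
Context (R : realType) d (T : measurableType d) (P : probability T R).
Local Open Scope ereal_scope.

(** The head of the tuple is integrated outermost; for a concrete [n] this reduces by computation to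
    nested integrals. *)
Fixpoint iterated_integral n : (n.-tuple T -> \bar R) -> \bar R :=
  match n with
  | 0%N => fun f => f [tuple]
  | m.+1 => fun f =>
      \int[P]_x iterated_integral (fun y : m.-tuple T => f [tuple of x :: y])
  end.

Lemma integral_power_prob n (f : n.-tuple T -> \bar R) :
  measurable_fun setT f -> (forall x, 0 <= f x) ->
  \int[power_prob P n]_x f x = iterated_integral f.
Proof.
elim: n f => [|n IHn] f mf f0 /=; first by rewrite integral_dirac// diracT mul1e.
rewrite ge0_integral_distribution// fubini_tonelli1//=.
- apply: eq_integral => x _; rewrite /fubini_F /= IHn//.
  apply: (measurableT_comp mf).
  apply: (measurableT_comp (@measurable_pair_cons _ T n)).
  exact: measurable_pair1.
- apply: (measurableT_comp mf); exact: measurable_pair_cons.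
Qed.

(* The hypotheses say that the codegree [f] has mean 1 and variance 0. *)
Lemma codegree_const (V : T * T -> R) :
  measurable_fun setT V -> (forall z, (0 <= V z)%R) ->
  let f x y := \int[P]_t (V (x, t) * V (y, t))%:E in
  \int[P]_x \int[P]_y f x y = 1 ->
  \int[P]_x \int[P]_y (f x y * f x y) = 1 ->
  \int[P]_x \int[P]_y ((V (x, y))%:E * f x y) = \int[P]_x \int[P]_y (V (x, y))%:E.
Proof.
move=> mV V0 f f1 f2; pose g (z : T * T) := f z.1 z.2.
have mg : measurable_fun setT g.
  pose h (u : (T * T) * T) := (V (u.1.1, u.2) * V (u.1.2, u.2))%:E.
  have mh : measurable_fun setT h.
    apply/measurable_EFinP; apply: measurable_funM; apply: (measurableT_comp mV).
      apply/measurable_fun_pair; last exact: measurable_snd.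
      exact: (measurableT_comp measurable_fst measurable_fst).
    apply/measurable_fun_pair; last exact: measurable_snd.
    exact: (measurableT_comp measurable_snd measurable_fst).
  have := @measurable_fun_fubini_tonelli_F _ _ _ _ R P h mh.
  by apply => u; rewrite lee_fin mulr_ge0.
have g0 z : 0 <= g z by apply: integral_ge0 => t _; rewrite lee_fin mulr_ge0.
have mVE : measurable_fun setT (EFin \o V) by exact/measurable_EFinP.
have prodE (h : T * T -> \bar R) : measurable_fun setT h -> (forall z, 0 <= h z) ->
    \int[P]_x \int[P]_y h (x, y) = \int[P \x P]_z h z.
  by move=> mh h0; rewrite fubini_tonelli1.
have mgg : measurable_fun setT (fun z => g z * g z) by exact: emeasurable_funM.
have G1 : \int[P \x P]_z g z = 1 by rewrite -prodE.
have G2 : \int[P \x P]_z (g z * g z) = 1.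
  by rewrite -prodE// => z; rewrite mule_ge0.
pose v z := (g z - 1) * (g z - 1).
have mv : measurable_fun setT v.
  by apply: emeasurable_funM; apply: emeasurable_funB => //; exact: measurable_cst.
have v0 z : 0 <= v z by rewrite /v -expe2 sqre_ge0.
(* The square is expanded without subtraction, so that integrals of nonnegative functions can be
   added and the identity also holds where [g z] is infinite. *)
have vE z : v z + (g z + g z) = g z * g z + 1.
  rewrite /v; have := g0 z; case: (g z) => [r|//|//] r0.
  by rewrite -EFinB -!EFinM -!EFinD; congr (_%:E); ring.
have V1 : \int[P \x P]_z v z = 0.
  have : \int[P \x P]_z (v z + (g z + g z)) = 2.
    under eq_integral do rewrite vE.
    rewrite ge0_integralD//; last by move=> z _; rewrite mule_ge0.
    rewrite G2 integral_cst// mul1e [X in 1 + X](_ : _ = 1)//.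
    by have := probability_setT (P \x P)%E.
  rewrite ge0_integralD//; last 2 first.
  - by move=> z _; rewrite adde_ge0.
  - exact: emeasurable_funD.
  rewrite ge0_integralD// G1.
  have : 0 <= \int[P \x P]_z v z by exact: integral_ge0.
  case: (\int[P \x P]_z v z) => // r _.
  by rewrite -!EFinD => -[] e; congr (_%:E); lra.
have ae1 : ae_eq (P \x P) setT v (cst 0).
  apply/ae_eq_integral_abs => //.
  by under eq_integral do rewrite gee0_abs//.
have mVg : measurable_fun setT (fun z => (V z)%:E * g z).
  exact: emeasurable_funM.
have VE0 z : 0 <= (V z)%:E by rewrite lee_fin.
rewrite (prodE (fun z => (V z)%:E * g z))//; last by move=> z; rewrite mule_ge0.
rewrite (prodE (fun z => (V z)%:E))//.
apply: ge0_ae_eq_integral => //.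
  by move=> z _; rewrite mule_ge0.
apply: filterS ae1 => z /= /(_ I); rewrite /v => vz _.
suff -> : g z = 1 by rewrite mule1.
move: vz; have := g0 z; case: (g z) => [r|//|//] _.
by rewrite -EFinB -EFinM => -[] /eqP; rewrite mulf_eq0 orbb subr_eq0 => /eqP ->.
Qed.

End IteratedIntegral.

(** * Test graphs on few vertices *)

Section SmallGraphs.
Variables (n : nat) (s : seq (nat * nat)).

Definition edge_rel : rel 'I_n :=
  fun i j => ((val i, val j) \in s) || ((val j, val i) \in s).

Lemma edge_rel_sym : symmetric edge_rel.
Proof. by move=> i j; rewrite /edge_rel orbC. Qed.

Lemma edge_rel_irr : all (fun e => e.1 != e.2) s -> irreflexive edge_rel.
Proof.
by move=> /allP h i; apply/negbTE/negP; rewrite /edge_rel orbb => /h; rewrite eqxx.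
Qed.

Definition edge_graph (h : all (fun e => e.1 != e.2) s) : sgraph :=
  SGraph edge_rel_sym (edge_rel_irr h).

End SmallGraphs.

Definition single_edge_graph := @edge_graph 2 [:: (0, 1)]%N isT.
(** In this graph and the next two, vertices 0 and 1 come first and the others are common neighbors
    of them, so the inner integrals give the codegree of the first two coordinates. *)
Definition cherry_graph := @edge_graph 3 [:: (0, 2); (1, 2)]%N isT.
Definition triangle_graph := @edge_graph 3 [:: (0, 1); (0, 2); (1, 2)]%N isT.
Definition square_graph := @edge_graph 4 [:: (0, 2); (0, 3); (1, 2); (1, 3)]%N isT.

Lemma triangle_free (F : sgraph) :
  (forall x y z : F, adj x y -> adj x z -> ~~ adj y z) -> #|triangles F| = 0%N.
Proof.
move=> h; apply/eqP; rewrite cards_eq0; apply/eqP/finset.setP => T.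
rewrite [RHS]inE; apply/negP => /trianglesP[T3 Tadj].
have /card_gt2P[x [y [z [[xT yT zT] [xy yz zx]]]]] : (2 < #|T|)%N by rewrite T3.
have := h x y z (Tadj _ _ xT yT xy); rewrite Tadj // 1?eq_sym// => /(_ isT).
by rewrite Tadj.
Qed.

Lemma triangles_single_edge : #|triangles single_edge_graph| = 0%N.
Proof.
by apply: triangle_free => -[[|[|[|[|]]]] ?] // [[|[|[|[|]]]] ?] // [[|[|[|[|]]]] ?].
Qed.

Lemma triangles_cherry : #|triangles cherry_graph| = 0%N.
Proof.
by apply: triangle_free => -[[|[|[|[|]]]] ?] // [[|[|[|[|]]]] ?] // [[|[|[|[|]]]] ?].
Qed.

Lemma triangles_square : #|triangles square_graph| = 0%N.
Proof.
by apply: triangle_free => -[[|[|[|[|]]]] ?] // [[|[|[|[|]]]] ?] // [[|[|[|[|]]]] ?].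
Qed.

Lemma triangles_triangle : (0 < #|triangles triangle_graph|)%N.
Proof.
apply/card_gt0P; exists [set: 'I_3]%SET; rewrite inE cardsT card_ord eqxx /=.
apply/forall_inP => -[[|[|[|[|]]]] ?] // _;
  by apply/forall_inP => -[[|[|[|[|]]]] ?].
Qed.

(** * Densities of the test graphs and nonexistence of a kernel *)

Section NoKernel.
Variable R : realType.
Local Notation P := (uniform_prob (@ltr01 R)).

Lemma kernel_density_ord n (a : rel 'I_n) (a_sym : symmetric a)
    (a_irr : irreflexive a) (W : R * R -> R) :
  kernel_density (SGraph a_sym a_irr) W =
  (\int[power_prob P n]_(x in @unit_cube R n)
    (\prod_(i < n) \prod_(j < n | a i j && (i < j)%N)
      W (tnth x i, tnth x j))%R%:E)%E.
Proof.
rewrite /kernel_density /=.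
have -> : (fun x : #|'I_n|.-tuple R => (\prod_(e in edges (SGraph a_sym a_irr))
    W (tnth x (enum_rank e.1), tnth x (enum_rank e.2)))%R%:E) =
  (fun x : #|'I_n|.-tuple R => (\prod_(i < n) \prod_(j < n | a i j && (i < j)%N)
      W (tnth x (cast_ord (esym (card_ord n)) i),
         tnth x (cast_ord (esym (card_ord n)) j)))%R%:E).
  apply/funext => x; congr (_%:E).
  rewrite pair_big_dep /=; apply: eq_big => [[i j]|[i j] _] /=.
    by rewrite inE /= !enum_rank_ord.
  by rewrite !enum_rank_ord.
(* The cardinal of ['I_n] equals [n] only propositionally; generalizing it turns the casts into
   identities. *)
move: (esym (card_ord n)); move: #|'I_n| => m nm; subst m.
by apply: eq_integral => x _; congr (_%:E);
  apply: eq_bigr => i _; apply: eq_bigr => j _; rewrite !cast_ord_id.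
Qed.

Variable W : R * R -> R.
Hypothesis kW : is_kernel W.

(** Extending [W] by zero gives a nonnegative function measurable on the whole plane, as Tonelli
    requires. *)
Let V : R * R -> R := W \_ (`[0, 1]%classic `*` `[0, 1]%classic).

Let VE x y : x \in `[0, 1] -> y \in `[0, 1] -> V (x, y) = W (x, y).
Proof. by move=> x01 y01; rewrite /V patchE mem_set. Qed.

Let V0 x y : ~~ ((x \in `[0, 1]) && (y \in `[0, 1])) -> V (x, y) = 0.
Proof.
move=> xy; rewrite /V patchE memNset//= => -[/= x01 y01].
by move: xy; rewrite x01 y01.
Qed.

Let V_ge0 z : 0 <= V z.
Proof.
case: z => x y; have [/andP[x01 y01]|/V0 ->//] :=
  boolP ((x \in `[0, 1]) && (y \in `[0, 1])).
by case: kW => _ W0 _; rewrite VE // W0.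
Qed.

Let measurable_V : measurable_fun setT V.
Proof.
case: kW => mW _ _; apply/(measurable_restrictT _ _).1 => //.
exact: measurableX.
Qed.

(** Outside the unit cube some coordinate leaves [0, 1]; its vertex has a neighbor, so a factor of
    [V] vanishes and the product of [V] is the extension by zero of the product of [W]. *)
Lemma kernel_density_iterated n (a : rel 'I_n) (a_sym : symmetric a)
    (a_irr : irreflexive a) : (forall i, exists j, a i j) ->
  kernel_density (SGraph a_sym a_irr) W =
  iterated_integral P (fun x : n.-tuple R =>
    (\prod_(i < n) \prod_(j < n | a i j && (i < j)%N)
      V (tnth x i, tnth x j))%R%:E).
Proof.
move=> a_cov; rewrite kernel_density_ord integral_mkcond -integral_power_prob.
- apply: eq_integral => x _; rewrite patchE; case: ifPn.
    rewrite inE => x01; congr (_%:E); apply: eq_bigr => i _.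
    by apply: eq_bigr => j _; rewrite VE //; exact: x01.
  rewrite notin_setE => /existsNP[i /negP xi]; apply/esym; congr (_%:E).
  have [j aij] := a_cov i.
  have [ij|ji|/val_inj ij] := ltngtP i j.
  + by rewrite (bigD1 i)//= (bigD1 j) ?aij ?ij//= V0 ?(negbTE xi)// !mul0r.
  + rewrite (bigD1 j)//= (bigD1 i) ?[a j i]a_sym ?aij ?ji//=.
    by rewrite V0 ?(negbTE xi) ?andbF// !mul0r.
  + by rewrite ij a_irr in aij.
- apply/measurable_EFinP; apply: measurable_prod => i _.
  under eq_fun do rewrite big_mkcond /=.
  apply: measurable_prod => j _; case: (_ && _); last exact: measurable_cst.
  apply: (measurableT_comp measurable_V).
  by apply/measurable_fun_pair; exact: measurable_tnth.
- by move=> x; rewrite lee_fin; apply: prodr_ge0 => i _; apply: prodr_ge0.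
Qed.

Let f x y : \bar R := (\int[P]_t (V (x, t) * V (y, t))%:E)%E.

Let cherry_density : kernel_density cherry_graph W = (\int[P]_x \int[P]_y f x y)%E.
Proof.
rewrite kernel_density_iterated /=; last first.
  by case=> -[|[|[|//]]] ?; [exists ord_max|exists ord_max|exists ord0].
apply: eq_integral => x _; apply: eq_integral => y _; apply: eq_integral => t _.
congr (_%:E); under eq_bigr do rewrite big_mkcond /=.
by rewrite !big_ord_recl !big_ord0 /= !mulr1 !mul1r.
Qed.

Let single_edge_graph_density :
  kernel_density single_edge_graph W = (\int[P]_x \int[P]_y (V (x, y))%:E)%E.
Proof.
rewrite kernel_density_iterated /=; last first.
  by case=> -[|[|//]] ?; [exists ord_max|exists ord0].
apply: eq_integral => x _; apply: eq_integral => y _.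
congr (_%:E); under eq_bigr do rewrite big_mkcond /=.
by rewrite !big_ord_recl !big_ord0 /= !mulr1 !mul1r.
Qed.

Let measurable_codegree x y :
  measurable_fun setT (fun t => (V (x, t) * V (y, t))%:E).
Proof.
by apply/measurable_EFinP; apply: measurable_funM;
  apply: (measurableT_comp measurable_V); exact: measurable_pair1.
Qed.

Let triangle_density : kernel_density triangle_graph W =
  (\int[P]_x \int[P]_y ((V (x, y))%:E * f x y))%E.
Proof.
rewrite kernel_density_iterated /=; last first.
  by case=> -[|[|[|//]]] ?; [exists ord_max|exists ord_max|exists ord0].
apply: eq_integral => x _; apply: eq_integral => y _.
have c0 t : (0 <= (V (x, t) * V (y, t))%:E)%E by rewrite lee_fin mulr_ge0.
have Vxy0 : (0 <= (V (x, y))%:E)%E by rewrite lee_fin.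
rewrite -ge0_integralZl//; last exact: measurable_codegree.
apply: eq_integral => t _; rewrite -EFinM.
congr (_%:E); under eq_bigr do rewrite big_mkcond /=.
by rewrite !big_ord_recl !big_ord0 /= !mulr1 !mul1r mulrA.
Qed.

Let square_density : kernel_density square_graph W =
  (\int[P]_x \int[P]_y (f x y * f x y))%E.
Proof.
rewrite kernel_density_iterated /=; last first.
  case=> -[|[|[|[|//]]]] ?;
    by [exists ord_max|exists ord_max|exists ord0|exists ord0].
apply: eq_integral => x _; apply: eq_integral => y _.
have c0 t : (0 <= (V (x, t) * V (y, t))%:E)%E by rewrite lee_fin mulr_ge0.
(* The product of two copies of [f x y] is unfolded into a double integral, one variable for each of
   the vertices 2 and 3. *)
rewrite -ge0_integralZr//; [|exact: measurable_codegree|exact: integral_ge0].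
apply: eq_integral => t _; rewrite -ge0_integralZl//; last exact: measurable_codegree.
apply: eq_integral => u _; rewrite -EFinM.
congr (_%:E); under eq_bigr do rewrite big_mkcond /=.
by rewrite !big_ord_recl !big_ord0 /= !mulr1 !mul1r mulrACA.
Qed.

Lemma kernel_density_not_triangle_exp :
  ~ forall F : sgraph, kernel_density F W = (expR (- #|triangles F|%:R))%:E.
Proof.
move=> WE; have c1 := WE cherry_graph; have s1 := WE square_graph.
have e1 := WE single_edge_graph; have t1 := WE triangle_graph.
rewrite cherry_density triangles_cherry oppr0 expR0 in c1.
rewrite square_density triangles_square oppr0 expR0 in s1.
rewrite single_edge_graph_density triangles_single_edge oppr0 expR0 in e1.
rewrite triangle_density in t1.
have ct := @codegree_const R _ _ P V measurable_V V_ge0 c1 s1.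
(* The triangle density equals the edge density 1, so the exponent vanishes and [triangle_graph]
   would have no triangle. *)
have [/eqP] := etrans (esym t1) (etrans ct e1).
rewrite -[X in _ == X]expR0 (inj_eq (@expR_inj R)) oppr_eq0 pnatr_eq0 => /eqP t0.
by have := triangles_triangle; rewrite t0.
Qed.

End NoKernel.

Theorem mainTheorem1 (R : realType) :
  (exists G : nat -> sgraph,
    [/\ #|G n| @[n --> \oo] --> \oo,
        forall n, 0 < edge_density R (G n),
        exists2 eps : nat -> R, eps n @[n --> \oo] --> (0 : R) &
          forall n, edge_density R (G n) = #|G n|%:R `^ (- eps n) &
        forall F : sgraph,
          normalized_density (edge_density R (G n)) F (G n) @[n --> \oo]
            --> expR (- #|triangles F|%:R : R)])
  /\ ~ (exists W : R * R -> R,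
         is_kernel W /\
         forall F : sgraph,
           kernel_density F W = (expR (- #|triangles F|%:R))%:E).
Proof.
split; first exact: sparse_limit_sequence.
by move=> [W [kW WE]]; exact: kernel_density_not_triangle_exp kW WE.
Qed.
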